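(* Let $K$ be a finite field of order $q$, let $\mathbf{F}$ be the free group on $r\ge 1$ generators, and let $w\in\mathbf{F}$. Then there are a rational function $R\in\mathbb{Q}(x)$ and an integer $N_0$ such that for every $N\ge N_0$, $$\mathbb{E}_w[\mathrm{fix}]=R(q^N),$$ where $\mathbb{E}_w[\mathrm{fix}]$ denotes the expected number of vectors in $K^N$ fixed by a $w$-random element of $\mathrm{GL}_N(K)$.
   Context: $\mathbf{F}$ has a fixed basis $b_1,\ldots,b_r$. For $g_1,\ldots,g_r$ in a group $G$, $w(g_1,\ldots,g_r)\in G$ is the image of $w$ under the homomorphism $\mathbf{F}\to G$ sending $b_i\mapsto g_i$. A $w$-random element of $\mathrm{GL}_N(K)$ is $w(g_1,\ldots,g_r)$ where $g_1,\ldots,g_r$ are independent uniformly random elements of $\mathrm{GL}_N(K)$. $\mathrm{fix}(g)$ is the number of vectors $v\in K^N$ (row vectors) with $vg=v$. $\mathbb{E}_w[\mathrm{fix}]$ is the expected value of $\mathrm{fix}$ on a $w$-random element of $\mathrm{GL}_N(K)$ (a number for each $N\ge1$). $K$, $q$ and $w$ are fixed while $N$ varies. *)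

(* Defs.v *)
From HB Require Import structures.
From mathcomp Require Import all_boot all_order all_fingroup all_algebra.

Set Implicit Arguments.
Unset Strict Implicit.
Unset Printing Implicit Defensive.

Import GRing.Theory.

(* The free group on r generators, as the set of reduced words. The letter    *)
(* (i, false) stands for the basis element b_i and (i, true) for its inverse. *)

Definition letter (r : nat) : Type := ('I_r * bool)%type.

Definition linv r (a : letter r) : letter r := (a.1, ~~ a.2).

Definition reduced r (s : seq (letter r)) : bool :=
  sorted (fun a b => b != linv a) s.

Record free_group (r : nat) : Type := FreeGroup {
  word :> seq (letter r);
  word_reduced : reduced word
}.

HB.instance Definition _ r := [isSub for @word r].
HB.instance Definition _ r := [Choice of free_group r by <:].

Section FreeGroupTheory.

Variable r : nat.
Implicit Types (a b : letter r) (s t : seq (letter r)).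

Definition lcons a s : seq (letter r) :=
  if s is b :: s' then if b == linv a then s' else a :: s else [:: a].

Definition wmul s t : seq (letter r) := foldr lcons t s.

Definition winv s : seq (letter r) := rev (map (@linv r) s).

Lemma linvK : involutive (@linv r).
Proof. by case=> i e; rewrite /linv /= negbK. Qed.

Lemma reduced_behead a s : reduced (a :: s) -> reduced s.
Proof. exact: path_sorted. Qed.

Lemma reduced_lcons a s : reduced s -> reduced (lcons a s).
Proof.
case: s => [|b s] //= red_bs; case: ifPn => [_|ba]; first exact: path_sorted red_bs.
by rewrite /reduced /= ba.
Qed.

Lemma lcons_reduced a s : reduced (a :: s) -> lcons a s = a :: s.
Proof. by case: s => [|b s] //= /andP[/negPf->]. Qed.

Lemma lconsK a s : reduced s -> lcons (linv a) (lcons a s) = s.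
Proof.
case: s => [|b s] /= red_s; first by rewrite linvK eqxx.
case: eqP => [b_a|_] /=; last by rewrite linvK eqxx.
by rewrite -b_a lcons_reduced.
Qed.

Lemma reduced_wmul s t : reduced t -> reduced (wmul s t).
Proof. by move=> red_t; elim: s => //= a s; apply: reduced_lcons. Qed.

Lemma reduced_winv s : reduced s -> reduced (winv s).
Proof.
rewrite /reduced /winv rev_sorted sorted_map.
by apply: sub_sorted => a b /=; rewrite linvK eq_sym (can2_eq linvK linvK).
Qed.

Lemma wmul_lcons a s t :
  reduced t -> wmul (lcons a s) t = lcons a (wmul s t).
Proof.
case: s => [|b s] //= red_t; case: eqP => //= ->.
by rewrite -[in RHS](linvK a) linvK -{1}(linvK a) lconsK ?reduced_wmul.
Qed.

Lemma wmulA s t u : reduced u -> wmul s (wmul t u) = wmul (wmul s t) u.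
Proof. by move=> red_u; elim: s => //= a s ->; rewrite wmul_lcons. Qed.

Lemma wmul1 s : reduced s -> wmul s [::] = s.
Proof.
elim: s => //= a s IHs red_as.
by rewrite IHs ?lcons_reduced //; apply: reduced_behead red_as.
Qed.

Lemma wmulKV s t : reduced t -> wmul (winv s) (wmul s t) = t.
Proof.
move=> red_t; elim: s => //= a s IHs.
rewrite /winv /= rev_cons /wmul foldr_rcons lconsK ?IHs //.
exact: reduced_wmul.
Qed.

Lemma winvK : involutive winv.
Proof. by move=> s; rewrite /winv map_rev revK mapK //; apply: linvK. Qed.

Lemma wmulVw s : reduced s -> wmul (winv s) s = [::].
Proof. by move=> red_s; rewrite -{2}(wmul1 red_s) wmulKV. Qed.

Definition fg_one : free_group r := @FreeGroup r [::] isT.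
Definition fg_mul (u v : free_group r) : free_group r :=
  FreeGroup (reduced_wmul u (word_reduced v)).
Definition fg_inv (u : free_group r) : free_group r :=
  FreeGroup (reduced_winv (word_reduced u)).
Definition fg_gen (i : 'I_r) : free_group r := @FreeGroup r [:: (i, false)] isT.

Lemma fg_mulA : associative fg_mul.
Proof. by move=> u v w; apply/val_inj/wmulA/word_reduced. Qed.

Lemma fg_mul1g : left_id fg_one fg_mul.
Proof. by move=> u; apply/val_inj. Qed.

Lemma fg_mulg1 : right_id fg_one fg_mul.
Proof. by move=> u; apply/val_inj/wmul1/word_reduced. Qed.

Lemma fg_mulVg : left_inverse fg_one fg_inv fg_mul.
Proof. by move=> u; apply/val_inj/wmulVw/word_reduced. Qed.

Lemma fg_mulgV : right_inverse fg_one fg_inv fg_mul.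
Proof.
move=> u; apply/val_inj => /=.
by rewrite -{1}(winvK u) wmulVw // reduced_winv // word_reduced.
Qed.

End FreeGroupTheory.

HB.instance Definition _ r := isGroup.Build (free_group r)
  (@fg_mulA r) (@fg_mul1g r) (@fg_mulg1 r) (@fg_mulVg r) (@fg_mulgV r).

Section WordMap.

Local Open Scope group_scope.

Variables (G : groupType) (r : nat) (g : 'I_r -> G).

Definition letter_eval (a : letter r) : G := if a.2 then (g a.1)^-1 else g a.1.

(* w(g_1, ..., g_r): by word_eval_is_morphism, word_eval_gen and              *)
(* word_eval_unique, this is the image of w under the unique homomorphism     *)
(* sending each b_i to g_i.                                                   *)
Definition word_eval (w : free_group r) : G := \prod_(a <- w) letter_eval a.

Lemma letter_evalV a : letter_eval (linv a) = (letter_eval a)^-1.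
Proof. by case: a => i [] //=; rewrite /letter_eval /= invgK. Qed.

Lemma word_eval_is_morphism : monoid.monoid_morphism word_eval.
Proof.
split=> [|u v]; first by rewrite /word_eval big_nil.
rewrite /word_eval /=; elim: (word u) => [|a s IHs] /=.
  by rewrite big_nil mul1g.
rewrite big_cons -mulgA -IHs.
case: (wmul s v) => [|b t] /=; first by rewrite big_seq1 big_nil mulg1.
by case: eqP => [->|_]; rewrite !big_cons // letter_evalV mulKVg.
Qed.

HB.instance Definition _ :=
  isUMagmaMorphism.Build (free_group r) G word_eval word_eval_is_morphism.

Lemma word_eval_gen i : word_eval (fg_gen i) = g i.
Proof. by rewrite /word_eval /= big_seq1. Qed.

Lemma word_eval_unique (f : free_group r -> G) :
  monoid.monoid_morphism f -> (forall i, f (fg_gen i) = g i) -> f =1 word_eval.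
Proof.
case=> f1 fM fg [s red_s]; elim: s red_s => [|a s IHs] red_as.
  have ->: FreeGroup red_as = 1 by apply/val_inj.
  by rewrite f1 gmulf1.
have red_s := reduced_behead red_as.
have red_a : reduced [:: a] by [].
have ->: FreeGroup red_as = FreeGroup red_a * FreeGroup red_s.
  by apply/val_inj; rewrite /= lcons_reduced.
rewrite fM gmulfM IHs /=; congr (_ * _).
case: a red_a {red_as} => i [] red_a; last first.
  have ->: FreeGroup red_a = fg_gen i by apply/val_inj.
  by rewrite fg word_eval_gen.
have ->: FreeGroup red_a = (fg_gen i)^-1 by apply/val_inj.
by rewrite gmulfV /= word_eval_gen -fg -[LHS]mulg1 -(mulgV (f (fg_gen i))) mulgA
           -fM mulVg f1 mul1g.
Qed.

End WordMap.

Section Expectation.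

Local Open Scope ring_scope.

Variables (K : finFieldType) (N : nat).

(* The dimension N.-1.+1 (= N for N > 0) comes from the definition of         *)
(* {'GL_N[K]}.                                                                *)
Definition fix_count (x : {'GL_N[K]}) : nat :=
  #|[set v : 'rV[K]_N.-1.+1 | v *m GLval x == v]|.

(* Mean over the uniform distribution on GL_N(K)^r: the components of a       *)
(* uniform r-tuple are independent and uniform.                               *)
Definition expected_fix (r : nat) (w : free_group r) : rat :=
  (\sum_(g : {ffun 'I_r -> {'GL_N[K]}}) (fix_count (word_eval g w))%:R)
    / #|{ffun 'I_r -> {'GL_N[K]}}|%:R.

End Expectation.

Section RationalFunction.

Local Notation "p %:F" := (FracField.tofrac p) : ring_scope.

Local Open Scope ring_scope.

Variable F : fieldType.

(* f has no pole at x, and its value there is y. The witness p / q need not   *)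
(* be in lowest terms, but q must not vanish at x.                            *)
Definition ratfun_value (f : {fraction {poly F}}) (x y : F) : Prop :=
  exists p q : {poly F},
    [/\ q.[x] != 0, f = p%:F / q%:F & y = p.[x] / q.[x]].

Lemma ratfun_value_unique f x y z :
  ratfun_value f x y -> ratfun_value f x z -> y = z.
Proof.
move=> [p [q [qx -> ->]]] [p' [q' [q'x e ->]]].
have nz (t : {poly F}) : t.[x] != 0 -> t%:F != 0.
  by rewrite tofrac_eq0; apply: contraNneq => ->; rewrite horner0.
apply/eqP; rewrite eqr_div // -!hornerM; apply/eqP; congr (_.[x]).
apply/eqP; rewrite -tofrac_eq !tofracM.
by rewrite -eqr_div ?nz // e.
Qed.

End RationalFunction.

(* Main.v *)
Require Import Defs.
From mathcomp Require Import all_boot all_order all_fingroup all_algebra.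
Local Open Scope ring_scope.

Set Implicit Arguments.
Unset Strict Implicit.
Unset Printing Implicit Defensive.

Import GRing.Theory Num.Theory.

(** Write N for the dimension, q for the order of K and L for the length of w.
    A vector v fixed by w(g_1, ..., g_r) is the same thing as a closed
    trajectory v_0 = v, v_1, ..., v_L = v_0, in which each letter of w moves
    v_(j-1) to v_j. Each step is one equation x g_i = y between two of the
    vectors v_j, a letter b_i^-1 being read from right to left. So the total
    number of fixed vectors, over all (g_1, ..., g_r), counts the pairs of a
    tuple g and a matrix V with rows v_0, ..., v_L such that
    S_i V g_i = T_i V for all i, where S_i and T_i select the sources and the
    targets of the steps that use g_i, and such that V is closed
    ([card_solutions_word]).

    Fix V and average over g first. The g_i are independent, and X g = Y has a
    solution g in GL_N(K) exactly when X and Y have the same column space; the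
    matrices Y with a given column space of rank d then form one GL_N(K)-orbit,
    of size (q^N - 1)(q^N - q)...(q^N - q^(d-1)), so by orbit-stabiliser the
    probability that X g = Y is the inverse of this number if X and Y have the
    same column space, and 0 otherwise ([card_GL_transporter],
    [card_col_space]). The size of the orbit is a polynomial in q^N which
    depends on q and d only.

    The closing condition, the compatibility of S_i V with T_i V and the rank
    of S_i V depend only on the column space U of V, a subspace of K^(L+1), and
    the number of V with column space U is again such a polynomial in q^N.
    There are finitely many U, independently of N, so the expectation is a
    fixed finite sum of quotients of polynomials evaluated at q^N
    ([mean_solutions]). All ranks are at most L+1, hence no denominator
    vanishes once N is at least L+1. *)

(** * The polynomials counting frames *)

(** The polynomial (x - 1)(x - q)...(x - q^(d-1)); at x = q^n it counts the
    linearly independent d-tuples in a space of dimension n over a field of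
    order q. *)
Definition qfall (q d : nat) : {poly rat} :=
  \prod_(j < d) ('X - ((q ^ j)%:R)%:P).

Lemma horner_qfall q d (x : rat) :
  (qfall q d).[x] = \prod_(j < d) (x - (q ^ j)%:R).
Proof. by rewrite horner_prod; apply: eq_bigr => j _; rewrite !hornerE. Qed.

Lemma horner_qfallS q d (x : rat) :
  (qfall q d.+1).[x] = (qfall q d).[x] * (x - (q ^ d)%:R).
Proof. by rewrite !horner_qfall big_ord_recr. Qed.

Lemma qfall_neq0 q d n :
  (1 < q)%N -> (d <= n)%N -> (qfall q d).[(q ^ n)%:R] != 0.
Proof.
move=> q_gt1 le_dn; rewrite horner_qfall; apply/prodf_neq0 => j _.
rewrite subr_eq0 eqr_nat eqn_exp2l // gtn_eqF //.
exact: leq_trans (ltn_ord j) le_dn.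
Qed.

(** * Sums of indicators *)

Lemma natr_andb (b1 b2 : bool) : (b1 && b2)%:R = b1%:R * b2%:R :> rat.
Proof. by case: b1; rewrite /= ?mul0r ?mul1r. Qed.

Lemma natr_forallb (I : finType) (P : pred I) :
  [forall i, P i]%:R = \prod_i (P i)%:R :> rat.
Proof.
have [/forallP allP | ] := boolP [forall i, P i].
  by rewrite big1 // => i _; rewrite allP.
rewrite negb_forall => /existsP[i /negbTE Pi].
by rewrite (bigD1 i) //= Pi mul0r.
Qed.

Lemma natr_card (I : finType) (A : {set I}) : #|A|%:R = \sum_x (x \in A)%:R :> rat.
Proof.
rewrite -sum1_card natr_sum big_mkcond.
by apply: eq_bigr => x _; case: (x \in A).
Qed.

(** * Values of sums of rational functions *)

Section RatfunValue.

Variables (F : fieldType) (x : F).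

Lemma ratfun_value_div (p d : {poly F}) :
  d.[x] != 0 ->
  ratfun_value (FracField.tofrac p / FracField.tofrac d) x (p.[x] / d.[x]).
Proof. by exists p, d. Qed.

Lemma ratfun_value0 : ratfun_value 0 x 0.
Proof.
exists 0, 1; rewrite hornerC oner_eq0 horner0 tofrac0 !mul0r.
by split.
Qed.

Lemma ratfun_valueD f g y z :
  ratfun_value f x y -> ratfun_value g x z -> ratfun_value (f + g) x (y + z).
Proof.
move=> [p [d [dx -> ->]]] [p' [d' [d'x -> ->]]].
have nz (t : {poly F}) : t.[x] != 0 -> FracField.tofrac t != 0.
  by rewrite tofrac_eq0; apply: contraNneq => ->; rewrite horner0.
exists (p * d' + p' * d), (d * d').
rewrite hornerM mulf_neq0 // addf_div ?nz // addf_div //.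
by rewrite !tofracD !tofracM hornerD !hornerM.
Qed.

Lemma ratfun_value_sum (I : finType) (P : pred I) (f : I -> {fraction {poly F}}) y :
  (forall i, P i -> ratfun_value (f i) x (y i)) ->
  ratfun_value (\sum_(i | P i) f i) x (\sum_(i | P i) y i).
Proof.
move=> fP; apply: (big_rec2 (fun s t => ratfun_value s x t)) => [|i t s /fP].
  exact: ratfun_value0.
exact: ratfun_valueD.
Qed.

End RatfunValue.

(** * Orbits of GL_n on matrices *)

Section Counting.

Variable K : finFieldType.
Local Notation q := #|K|.

Lemma row_free_col_mx n d (v : 'rV[K]_n) (B : 'M[K]_(d, n)) :
  row_free (col_mx v B) = row_free B && ~~ (v <= B)%MS.
Proof.
rewrite /row_free -addsmxE.
have le_sum : (\rank (v + B)%MS <= 1 + \rank B)%N.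
  apply: leq_trans (mxrank_adds_leqif v B) _.
  by rewrite leq_add2r rank_leq_row.
have le_B : (\rank B <= d)%N := rank_leq_row B.
have [sub_vB | not_vB] := boolP (v <= B)%MS.
  rewrite andbF; apply/negbTE; rewrite neq_ltn; apply/orP; left.
  have /eqmxP sumE : (v + B == B)%MS.
    by rewrite addsmxSr addsmx_sub sub_vB submx_refl.
  by rewrite sumE ltnS.
rewrite andbT.
have : (B < v + B)%MS by rewrite /ltmx addsmxSr addsmx_sub (negbTE not_vB).
rewrite ltmxErank addsmxSr /= => lt_B.
have /eqP -> : \rank (v + B)%MS == (1 + \rank B)%N by rewrite eqn_leq le_sum.
by rewrite eqn_add2l.
Qed.

Lemma card_row_space n d (B : 'M[K]_(d, n)) :
  row_free B -> #|[set v : 'rV_n | (v <= B)%MS]| = (q ^ d)%N.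
Proof.
move=> freeB.
have -> : [set v : 'rV_n | (v <= B)%MS] = [set u *m B | u : 'rV[K]_d].
  apply/setP=> v; rewrite inE; apply/submxP/imsetP => [[D ->] | [D _ ->]].
    by exists D.
  by exists D.
by rewrite card_imset ?card_mx ?mul1n; last exact: row_free_inj.
Qed.

(** A row-free matrix is built row by row, the next row being any of the
    q^n - q^d vectors outside the span of the d rows already chosen. *)
Lemma card_row_free d n :
  #|[set B : 'M[K]_(d, n) | row_free B]|%:R = (qfall q d).[(q ^ n)%:R].
Proof.
elim: d => [|d IHd].
  rewrite horner_qfall big_ord0.
  have -> : [set B : 'M[K]_(0, n) | row_free B] = setT.
    by apply/setP=> B; rewrite !inE /row_free -leqn0 rank_leq_row.
  by rewrite cardsT card_mx.
rewrite horner_qfallS -IHd -sum1_card natr_sum.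
rewrite (reindex (fun p : 'rV_n * 'M_(d, n) =>
                    col_mx p.1 p.2 : 'M_(1 + d, n))) /=; last first.
  exists (fun A : 'M_(1 + d, n) => (usubmx A, dsubmx A)) => [[v B] _ | A _] /=.
    by rewrite col_mxKu col_mxKd.
  by rewrite vsubmxK.
under eq_bigl => p do rewrite inE row_free_col_mx.
rewrite -(pair_big_dep xpredT
            (fun (v : 'rV[K]_n) B => row_free B && ~~ (v <= B)%MS)
            (fun _ _ => 1)) /=.
rewrite (exchange_big_dep (fun B : 'M[K]_(d, n) => row_free B)) /=; last first.
  by move=> v B _ /andP[].
rewrite (eq_bigr (fun=> (q ^ n)%:R - (q ^ d)%:R)).
  rewrite sumr_const mulr_natl; congr (_ *+ _).
  by apply: eq_card => B; rewrite !inE.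
move=> B freeB.
rewrite (eq_bigl (mem (~: [set v : 'rV_n | (v <= B)%MS]))); last first.
  by move=> v; rewrite freeB !inE.
rewrite sumr_const cardsCs setCK card_row_space // card_mx mul1n natrB //.
rewrite -(card_row_space freeB) -[n in (q ^ n)%N]mul1n -card_mx.
exact: max_card.
Qed.

(** With Z a fixed basis of the row space of U, the matrices Y whose
    transpose has that row space are the B^T Z for row-free B, transposed. If
    the rank of U exceeds n then both sides are 0, because q^n - q^n is a factor
    of the right one. *)
Lemma card_col_space m n p (U : 'M[K]_(p, m)) :
  #|[set Y : 'M[K]_(m, n) | (Y^T == U)%MS]|%:R
    = (qfall q (\rank U)).[(q ^ n)%:R].
Proof.
rewrite -card_row_free; congr _%:R; set Z := row_base U.
have freeZ : row_free Z := row_base_free U.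
have eqZ := eq_row_base U.
rewrite -(card_imset [set B | row_free B]
                     (f := fun B => (B^T *m Z)^T)); last first.
  by move=> B B' /trmx_inj /(row_free_inj freeZ) /trmx_inj.
apply: eq_card => Y; rewrite inE.
have -> : (Y^T == U)%MS = (Y^T == Z)%MS by rewrite !eqZ.
apply/idP/imsetP => [eqYZ | [B]].
  have /submxP[D defD] : (Y^T <= Z)%MS by case/andP: eqYZ.
  exists D^T; last by rewrite trmxK -defD trmxK.
  rewrite inE /row_free mxrank_tr -(mxrankMfree D freeZ) -defD.
  by rewrite (eqmxP eqYZ) (eqP freeZ).
rewrite inE => freeB ->; rewrite trmxK.
have := mxrank_leqif_eq (submxMl B^T Z).
by move=> [_ <-]; rewrite mxrankMfree // mxrank_tr (eqP freeB) (eqP freeZ).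
Qed.

Lemma GL_transporterP m n (X Y : 'M[K]_(m, n.-1.+1)) :
  reflect (exists g : {'GL_n[K]}, X *m GLval g = Y) (Y^T == X^T)%MS.
Proof.
apply: (iffP (eqmxMunitP _ _)) => [[P unitP defY] | [g <-]].
  have unitPt : P^T \is a GRing.unit.
    by rewrite -[_ \is a _]/(_ \in unitmx) unitmx_tr.
  exists (FinRing.Unit unitPt).
  by apply: trmx_inj; rewrite trmx_mul trmxK.
exists (GLval g)^T; last exact: trmx_mul.
by rewrite unitmx_tr GL_unitmx.
Qed.

(** Orbit-stabiliser for right multiplication on matrices: the nonempty
    transporters from X to the points of its orbit are all equinumerous, and
    the orbit is the set of matrices with the column space of X. *)
Lemma card_GL_transporter m n (X Y : 'M[K]_(m, n.-1.+1)) :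
  #|[set g : {'GL_n[K]} | X *m GLval g == Y]|%:R / #|{: {'GL_n[K]}}|%:R
    = (Y^T == X^T)%MS%:R / (qfall q (\rank X)).[(q ^ n.-1.+1)%:R] :> rat.
Proof.
case: GL_transporterP => [[h defY] | no_g]; last first.
  rewrite mul0r (_ : [set _ | _] = set0) ?cards0 ?mul0r //.
  by apply/setP=> g; rewrite !inE; apply/eqP=> gP; case: no_g; exists g.
pose orb := [set Z : 'M[K]_(m, n.-1.+1) | (Z^T == X^T)%MS].
(* Any k moving X to Z carries the transporter to Y onto the one to Z, by
   right multiplication by h^-1 k. *)
have card_fiber Z : Z \in orb ->
    #|[set g : {'GL_n[K]} | X *m GLval g == Z]| =
    #|[set g : {'GL_n[K]} | X *m GLval g == Y]|.
  rewrite inE => /GL_transporterP[k defZ].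
  rewrite -[RHS](card_imset _ (mulIg (h^-1 * k)%g)).
  apply: eq_card => g; rewrite inE; apply/idP/imsetP => [/eqP gZ | [g']].
    exists (g * (h^-1 * k)^-1)%g; last by rewrite mulgKV.
    rewrite inE invMg invgK mulgA !GL_MxE !mulmxA gZ -defZ -defY.
    by rewrite -(mulmxA X) -GL_MxE mulgV mulmx1.
  rewrite inE => /eqP g'Y ->.
  by rewrite !GL_MxE !mulmxA g'Y -defY -(mulmxA X) -GL_MxE mulgV mulmx1 defZ.
have sum_GL : #|{: {'GL_n[K]}}| =
    (#|orb| * #|[set g : {'GL_n[K]} | X *m GLval g == Y]|)%N.
  rewrite -[LHS]sum1_card.
  rewrite (partition_big (fun g : {'GL_n[K]} => X *m GLval g)
                         (fun Z => Z \in orb)) /=; last first.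
    by move=> g _; rewrite inE; apply/GL_transporterP; exists g.
  under eq_bigr => Z orbZ do rewrite sum1dep_card card_fiber //.
  by rewrite sum_nat_const.
rewrite -(mxrank_tr X) -card_col_space -/orb sum_GL natrM.
have neq0 : #|[set g : {'GL_n[K]} | X *m GLval g == Y]|%:R != 0 :> rat.
  rewrite pnatr_eq0 -lt0n; apply/card_gt0P; exists h.
  by rewrite inE defY.
by rewrite invfM mulrCA divff // mulr1 mul1r.
Qed.

End Counting.

(** * Random linear systems over GL_n *)

Section RelationSystem.

Variables (K : finFieldType) (r L M c : nat).
Variables (S T : 'I_r -> 'M[K]_(L, M)) (C : 'M[K]_(c, M)).
Local Notation q := #|K|.

(** Here U stands for the transpose of V, so that the row space of U is the
    column space of V: the condition says that C V = 0 and that S_i V and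
    T_i V lie in the same orbit for every i. *)
Definition admissible p (U : 'M[K]_(p, M)) : bool :=
  (U *m C^T == 0) && [forall i, (U *m (T i)^T == U *m (S i)^T)%MS].

Definition orbit_num p (U : 'M[K]_(p, M)) : {poly rat} := qfall q (\rank U).

Definition orbit_den p (U : 'M[K]_(p, M)) : {poly rat} :=
  \prod_i qfall q (\rank (U *m (S i)^T)).

(** This lemma and the next allow the sum over the matrices V, whose size
    depends on n, to be replaced by a sum over the subspaces of K^M. *)
Lemma eqmx_admissible p p' (U : 'M[K]_(p, M)) (U' : 'M[K]_(p', M)) :
  (U :=: U')%MS -> admissible U = admissible U'.
Proof.
move=> eqU; rewrite /admissible; congr andb.
  by rewrite -!submx0 (eqmxMr _ eqU).
by apply: eq_forallb => i; rewrite !(eqmxMr _ eqU).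
Qed.

Lemma eqmx_orbit_den p p' (U : 'M[K]_(p, M)) (U' : 'M[K]_(p', M)) :
  (U :=: U')%MS -> orbit_den U = orbit_den U'.
Proof. by move=> eqU; apply: eq_bigr => i _; rewrite (eqmxMr _ eqU). Qed.

Definition solutions n (g : {ffun 'I_r -> {'GL_n[K]}}) :
    {set 'M[K]_(M, n.-1.+1)} :=
  [set V | (C *m V == 0) &&
           [forall i, S i *m V *m GLval (g i) == T i *m V]].

(** For a given V the equations for distinct i involve distinct independent
    components of g, so the probability that V is a solution is a product of
    transporter probabilities. *)
Lemma mean_solutions_fixed n (V : 'M[K]_(M, n.-1.+1)) :
  (\sum_(g : {ffun 'I_r -> {'GL_n[K]}}) (V \in solutions g)%:R)
      / #|{ffun 'I_r -> {'GL_n[K]}}|%:R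
    = (admissible V^T)%:R / (orbit_den V^T).[(q ^ n.-1.+1)%:R] :> rat.
Proof.
rewrite /admissible -trmx_mul trmx_eq0 natr_andb natr_forallb.
have -> : \sum_(g : {ffun 'I_r -> {'GL_n[K]}}) (V \in solutions g)%:R
    = (C *m V == 0)%:R
      * \prod_i #|[set h : {'GL_n[K]} | S i *m V *m GLval h == T i *m V]|%:R :> rat.
  under [LHS]eq_bigr => g _ do rewrite inE natr_andb natr_forallb.
  rewrite -mulr_sumr; congr (_ * _).
  rewrite -(bigA_distr_bigA (fun i (h : {'GL_n[K]}) =>
                               (S i *m V *m GLval h == T i *m V)%:R)) /=.
  apply: eq_bigr => i _; rewrite natr_card.
  by apply: eq_bigr => h _; rewrite inE.
rewrite card_ffun card_ord natrX -!mulrA; congr (_ * _).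
have -> : #|{: {'GL_n[K]}}|%:R ^+ r
    = \prod_(i < r) #|{: {'GL_n[K]}}|%:R :> rat.
  by rewrite prodr_const card_ord.
rewrite horner_prod -!prodf_div; apply: eq_bigr => i _.
by rewrite -!trmx_mul mxrank_tr card_GL_transporter.
Qed.

(** Exchanging the two sums, then grouping the V by column space; each
    subspace of K^M is represented by its canonical generator <<U>>. The right
    side depends on n only through the point q^n at which it is evaluated. *)
Lemma mean_solutions n :
  (\sum_(g : {ffun 'I_r -> {'GL_n[K]}}) #|solutions g|%:R)
      / #|{ffun 'I_r -> {'GL_n[K]}}|%:R
    = \sum_(U : 'M[K]_M | (<<U>>%MS == U) && admissible U)
        (orbit_num U).[(q ^ n.-1.+1)%:R] / (orbit_den U).[(q ^ n.-1.+1)%:R]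
      :> rat.
Proof.
have -> : \sum_(g : {ffun 'I_r -> {'GL_n[K]}}) #|solutions g|%:R
   = \sum_V \sum_(g : {ffun 'I_r -> {'GL_n[K]}}) (V \in solutions g)%:R :> rat.
  by rewrite exchange_big; apply: eq_bigr => g _; apply: natr_card.
rewrite mulr_suml; under eq_bigr => V _ do rewrite mean_solutions_fixed.
rewrite (partition_big (fun V : 'M[K]_(M, n.-1.+1) => <<V^T>>%MS)
           (fun U => <<U>>%MS == U)) /=; last by move=> V _; rewrite genmx_id.
rewrite big_mkcondr /=; apply: eq_bigr => U /eqP genU.
rewrite (eq_bigr
           (fun=> (admissible U)%:R / (orbit_den U).[(q ^ n.-1.+1)%:R])).
  rewrite sumr_const -[LHS]mulr_natl.
  case: (admissible U); rewrite ?mul0r ?mulr0 // mul1r.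
  congr (_ / _).
  rewrite -card_col_space; congr _%:R; apply: eq_card => V.
  by rewrite inE -[LHS]/(<<V^T>>%MS == U) -[in LHS]genU; apply/eqP/genmxP.
move=> V /eqP defU; have eqV : (V^T :=: U)%MS.
  by rewrite -defU; apply/eqmxP; rewrite !genmxE submx_refl.
by rewrite (eqmx_admissible eqV) (eqmx_orbit_den eqV).
Qed.

End RelationSystem.

(** * Fixed vectors of a word as closed trajectories *)

Section WordTrajectories.

Variables (K : finFieldType) (r : nat) (w : free_group r).
Local Notation L := (size (word w)).

Definition nth_letter (j : 'I_L) : letter r := tnth (in_tuple (word w)) j.

(** For a letter b_i^-1 the step v_j g_i^-1 = v_(j+1) is turned into
    v_(j+1) g_i = v_j, so the source of the step is then the later vertex. *)
Definition step_source (j : 'I_L) : 'I_L.+1 :=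
  if (nth_letter j).2 then lift ord0 j else widen_ord (leqnSn L) j.

Definition step_target (j : 'I_L) : 'I_L.+1 :=
  if (nth_letter j).2 then widen_ord (leqnSn L) j else lift ord0 j.

(** The rows of the steps that use a generator other than b_i are 0, so that
    they contribute the trivial equation 0 = 0 to the i-th system. *)
Definition select_mx (f : 'I_L -> 'I_L.+1) (i : 'I_r) : 'M[K]_(L, L.+1) :=
  \matrix_(j < L) (if (nth_letter j).1 == i then delta_mx 0 (f j) else 0).

Definition closing_mx : 'rV[K]_L.+1 := delta_mx 0 ord0 - delta_mx 0 ord_max.

Lemma row_select_mx f i j m (V : 'M[K]_(L.+1, m)) :
  row j (select_mx f i *m V) = if (nth_letter j).1 == i then row (f j) V else 0.
Proof. by rewrite row_mul rowK; case: ifP => _; rewrite ?mul0mx // -rowE. Qed.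

Variable n : nat.
Implicit Types (g : {ffun 'I_r -> {'GL_n[K]}}) (V : 'M[K]_(L.+1, n.-1.+1)).

Lemma mulmx_GLVr m (x y : 'M[K]_(m, n.-1.+1)) (h : {'GL_n[K]}) :
  (x *m GLval h^-1%g == y) = (y *m GLval h == x).
Proof.
apply/eqP/eqP => <-; rewrite -mulmxA -GL_MxE ?mulVg ?mulgV; exact: mulmx1.
Qed.

Local Notation solutions :=
  (solutions (select_mx step_source) (select_mx step_target) closing_mx).

Lemma mem_solutions g V :
  (V \in solutions g) =
  (row ord0 V == row ord_max V) &&
  [forall j, row (widen_ord (leqnSn L) j) V
               *m GLval (letter_eval g (nth_letter j))
             == row (lift ord0 j) V].
Proof.
rewrite inE mulmxBl -!rowE subr_eq0; congr andb.
have step j :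
    (row (widen_ord (leqnSn L) j) V *m GLval (letter_eval g (nth_letter j))
       == row (lift ord0 j) V)
    = (row (step_source j) V *m GLval (g (nth_letter j).1)
       == row (step_target j) V).
  rewrite /letter_eval /step_source /step_target.
  by case: (nth_letter j).2 => //; apply: mulmx_GLVr.
apply/forallP/forallP => [sys j | steps i].
  rewrite step; have /eqP/(congr1 (row j)) := sys (nth_letter j).1.
  by rewrite row_mul !row_select_mx eqxx => ->.
apply/eqP/row_matrixP => j; rewrite row_mul !row_select_mx.
case: eqP => [<- | _]; last by rewrite mul0mx.
by apply/eqP; rewrite -step.
Qed.

Definition trajectory g (v : 'rV[K]_n.-1.+1) : 'M[K]_(L.+1, n.-1.+1) :=
  \matrix_(k < L.+1)
    (v *m GLval (\prod_(a <- take k (word w)) letter_eval g a)%g).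

Lemma row0_trajectory g v : row ord0 (trajectory g v) = v.
Proof. by rewrite rowK take0 big_nil mulmx1. Qed.

Lemma row_max_trajectory g v :
  row ord_max (trajectory g v) = v *m GLval (word_eval g w).
Proof. by rewrite rowK take_size. Qed.

Lemma prod_takeS g (j : 'I_L) :
  (\prod_(a <- take j.+1 (word w)) letter_eval g a
   = \prod_(a <- take j (word w)) letter_eval g a * letter_eval g (nth_letter j))%g.
Proof.
rewrite (take_nth (nth_letter j)) // big_rcons /=.
congr (_ * letter_eval g _)%g; exact/esym/tnth_nth.
Qed.

(** A solution is determined by its first row, since each step equation
    computes the next row from the previous one. *)
Lemma solutions_trajectory g V :
  V \in solutions g -> V = trajectory g (row ord0 V).
Proof.
rewrite mem_solutions => /andP[_ /forallP steps].
apply/row_matrixP => -[k lt_k]; rewrite rowK /=.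
elim: k lt_k => [|k IHk] lt_k.
  by rewrite take0 big_nil mulmx1; congr row; apply: val_inj.
have lt_kL : (k < L)%N by [].
rewrite (prod_takeS g (Ordinal lt_kL)) GL_MxE mulmxA -(IHk (ltnW lt_k)).
have -> : Ordinal lt_k = lift ord0 (Ordinal lt_kL) by apply: val_inj.
rewrite -(eqP (steps (Ordinal lt_kL))); congr (row _ _ *m _).
exact: val_inj.
Qed.

Lemma trajectory_solutions g v :
  (trajectory g v \in solutions g) = (v *m GLval (word_eval g w) == v).
Proof.
rewrite mem_solutions row0_trajectory row_max_trajectory eq_sym.
rewrite (_ : [forall j, _]) ?andbT //; apply/forallP => j.
by rewrite !rowK /= prod_takeS GL_MxE mulmxA.
Qed.

Lemma card_solutions_word g : #|solutions g| = fix_count (word_eval g w).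
Proof.
rewrite /fix_count -[RHS](card_imset _ (f := trajectory g)); last first.
  by apply: can_inj (fun V => row ord0 V) _ => v; rewrite row0_trajectory.
apply: eq_card => V; apply/idP/imsetP => [solV | [v]].
  exists (row ord0 V); last exact: solutions_trajectory.
  by rewrite inE -trajectory_solutions -solutions_trajectory.
by rewrite inE -trajectory_solutions => solv ->.
Qed.

End WordTrajectories.

Theorem theorem1p1 (K : finFieldType) (q : nat) (hq : #|K| = q)
    (r : nat) (hr : (1 <= r)%N) (w : free_group r) :
  exists (R : {fraction {poly rat}}) (N0 : nat),
    forall N : nat, (1 <= N)%N -> (N0 <= N)%N ->
      ratfun_value R ((q ^ N)%:R) (expected_fix K N w).
Proof.
pose L := size (word w).
pose S := select_mx K (@step_source r w).
pose T := select_mx K (@step_target r w).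
exists (\sum_(U : 'M[K]_L.+1
              | (<<U>>%MS == U) && admissible S T (closing_mx K w) U)
         FracField.tofrac (orbit_num U) / FracField.tofrac (orbit_den S U)), L.+1.
move=> N N_gt0 le_LN.
have -> : expected_fix K N w =
  (\sum_(g : {ffun 'I_r -> {'GL_N[K]}})
      #|solutions S T (closing_mx K w) g|%:R) / #|{ffun 'I_r -> {'GL_N[K]}}|%:R.
  by congr (_ / _); apply: eq_bigr => g _; rewrite card_solutions_word.
rewrite mean_solutions -hq prednK //.
apply: ratfun_value_sum => U _; apply: ratfun_value_div.
rewrite horner_prod; apply/prodf_neq0 => i _; apply: qfall_neq0.
  exact: card_finNzRing_gt1.
by apply: leq_trans le_LN; apply: leq_trans (rank_leq_row _).
Qed.
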